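(* For all LTL$_f$ formulas $\varphi_1,\varphi_2$ such that $\forall\varphi_2$ is consistent (some environment strategy enforces it), Algorithm 4 (described below) solves the synthesis under environment specifications problem with $\mathit{Task}=\exists\varphi_1$ and $\mathit{Env}=\forall\varphi_2$: if it outputs ''Unrealisable'' then no agent strategy enforces $\exists\varphi_1$ under $\forall\varphi_2$, and otherwise its output is a finite-state agent strategy that enforces $\exists\varphi_1$ under $\forall\varphi_2$. Algorithm 4: let $(\mathcal D_1,\mathrm{reach}(T_1))=\mathrm{ConvertDA}(\exists\varphi_1)$ with state set $Q_1$, and $(\mathcal D_2,\mathrm{safe}(T_2))=\mathrm{ConvertDA}(\forall\varphi_2)$. Compute $(S_2,f_{env})=\mathrm{Solve}_{env}(\mathcal D_2,\mathrm{safe}(T_2))$ (the environment being the protagonist). Let $\mathcal D_2'=\mathrm{Restrict}(\mathcal D_2,S_2)$ with sink $\bot_2$, and $\mathcal D=\mathrm{Product}(\mathcal D_1,\mathcal D_2')$ with initial state $\iota$. Compute $(R,f)=\mathrm{Solve}_{ag}(\mathcal D,\mathrm{reach}((T_1\times S_2)\cup(Q_1\times\{\bot_2\})))$. If $\iota\notin R$ output ''Unrealisable''; otherwise output $\mathrm{Strategy}(\mathcal D,f)$.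
   Context: Fix a finite set $\mathcal P$ of atomic propositions partitioned into disjoint sets $\mathcal X$ (environment-controlled) and $\mathcal Y$ (agent-controlled); $\Sigma=2^{\mathcal P}$. LTL$_f$ formulas: $\varphi ::= p \mid \neg\varphi\mid \varphi\wedge\varphi\mid \mathsf{X}\varphi\mid \varphi\,\mathsf{U}\,\varphi$, evaluated on finite nonempty traces with standard finite-trace semantics ($\mathsf X\varphi$ holds at $i$ iff $i<|\pi|-1$ and $\varphi$ holds at $i+1$; $\varphi_1\mathsf U\varphi_2$ holds at $i$ iff $\varphi_2$ holds at some $j$ with $i\le j<|\pi|$ and $\varphi_1$ holds at all $k$ with $i\le k<j$); $\pi\models\varphi$ means $\varphi$ holds at position 0. $\exists\varphi$ is the set of infinite traces with some finite nonempty prefix satisfying $\varphi$; $\forall\varphi$ is the set of infinite traces all of whose finite nonempty prefixes satisfy $\varphi$. Agent strategies are $\sigma_{ag}:(2^{\mathcal X})^*\to2^{\mathcal Y}$, environment strategies $\sigma_{env}:(2^{\mathcal Y})^+\to2^{\mathcal X}$; the agent moves first: $(Y_0\cup X_0)(Y_1\cup X_1)\cdots$ follows $\sigma_{ag}$ iff $Y_0=\sigma_{ag}(\epsilon)$, $Y_{i+1}=\sigma_{ag}(X_0\cdots X_i)$, and follows $\sigma_{env}$ iff $X_i=\sigma_{env}(Y_0\cdots Y_i)$; $\mathrm{play}(\sigma_{ag},\sigma_{env})$ is the unique trace following both. An environment strategy enforces $P\subseteq\Sigma^\omega$ iff its play against every agent strategy lies in $P$. $\sigma_{ag}$ enforces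 $\mathit{Task}$ under $\mathit{Env}$ iff $\mathrm{play}(\sigma_{ag},\sigma_{env})\in\mathit{Task}$ for every environment strategy $\sigma_{env}$ that enforces $\mathit{Env}$. A strategy is finite-state if computed by a finite-state transducer. Building blocks: a transition system $\mathcal D=(\Sigma,Q,\iota,\delta)$ ($Q$ finite, $\delta:Q\times\Sigma\to Q$); $\mathcal D_q$ is $\mathcal D$ with initial state $q$. For an LTL$_f$ formula $\varphi$ let $\mathcal M_\varphi=(\Sigma,Q,\iota,\delta,F)$ be a DFA accepting exactly the finite nonempty traces satisfying $\varphi$. For $T\subseteq Q$, $\mathrm{reach}(T)$ is the set of infinite runs visiting $T$ at some index $k\ge0$, $\mathrm{safe}(T)$ the set of infinite runs in $T$ at every index. $\mathrm{ConvertDA}(\exists\varphi)=((\Sigma,Q,\iota,\delta),\mathrm{reach}(F))$ and $\mathrm{ConvertDA}(\forall\varphi)=((\Sigma,Q,\iota,\delta),\mathrm{safe}(F\cup\{\iota\}))$. Game on $(\mathcal D,\alpha)$: an agent strategy wins from $q$ if the run of $\mathcal D_q$ on every infinite trace following it lies in $\alpha$; an environment strategy wins from $q$ if the run of $\mathcal D_q$ on every trace following it lies in $\alpha$. For $p\in\{ag,env\}$, $\mathrm{Solve}_p(\mathcal D,\alpha)$ (with $\alpha$ a reachability or safety condition) returns the winning region of $p$ (the set of states from which $p$ has a winning strategy) and a positional function (for $p=ag$, $f:Q\to2^{\mathcal Y}$; for $p=env$, $f:Q\times2^{\mathcal Y}\to2^{\mathcal X}$) whose induced strategy wins from every state of that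 region. For $f:Q\to2^{\mathcal Y}$, $\mathrm{Strategy}(\mathcal D,f)$ is the agent strategy with $\sigma(\epsilon)=f(\iota)$ and $\sigma(X_0\cdots X_k)=f(q_{k+1})$, where $q_0\cdots q_{k+1}$ is the run of $\mathcal D$ on $(Y_0\cup X_0)\cdots(Y_k\cup X_k)$ and $Y_0,\dots,Y_k$ are the agent's own previous moves under $\sigma$. $\mathrm{Restrict}(\mathcal D,S)$ for $S\subseteq Q$ is the transition system with states $S\cup\{\bot\}$ ($\bot$ a fresh sink), the same initial state, $\delta'(q,z)=\delta(q,z)$ if $\delta(q,z)\in S$, $\delta'(q,z)=\bot$ otherwise, and $\delta'(\bot,z)=\bot$. $\mathrm{Product}(\mathcal D_1,\mathcal D_2)$ is the synchronous product: states $Q_1\times Q_2$, initial state $(\iota_1,\iota_2)$, $\delta((q_1,q_2),z)=(\delta_1(q_1,z),\delta_2(q_2,z))$.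
   Formalization: The DFA for φ₂ is required never to re-enter its initial state on a nonempty word; without this safe(F∪{ι}) need not capture ∀φ₂ and the claim fails (e.g. φ₂ = ''p at the last position'' with its minimal DFA, φ₁ = p). Every LTLf formula has such a DFA. *)

(* Defs.v *)
From Corelib Require Import Setoid.
From mathcomp Require Import all_boot.

Set Implicit Arguments.
Unset Strict Implicit.
Unset Printing Implicit Defensive.

Section Ltlf.
Variables X Y : finType.

(* X and Y are the environment's and the agent's propositions; the set P they
   partition is their disjoint sum. *)
Definition letter := {set (X + Y)%type}.

Definition union_letter (y : {set Y}) (x : {set X}) : letter :=
  (@inr X Y @: y) :|: (@inl X Y @: x).
Definition ag_part (z : letter) : {set Y} := [set y | inr y \in z].
Definition env_part (z : letter) : {set X} := [set x | inl x \in z].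

Definition trace := nat -> letter.
Definition property := trace -> Prop.

Inductive ltlf : Type :=
| Atom of (X + Y)%type
| Neg of ltlf
| And of ltlf & ltlf
| Next of ltlf
| Until of ltlf & ltlf.

Fixpoint holds (w : seq letter) (i : nat) (phi : ltlf) : Prop :=
  match phi with
  | Atom p => p \in nth set0 w i
  | Neg f => ~ holds w i f
  | And f g => holds w i f /\ holds w i g
  | Next f => i < size w - 1 /\ holds w i.+1 f
  | Until f g => exists j, [/\ i <= j < size w, holds w j g
                           & forall k, i <= k < j -> holds w k f]
  end.

(* Only meaningful for w nonempty. *)
Definition sat (w : seq letter) (phi : ltlf) : Prop := holds w 0 phi.

Definition Exists_ltlf (phi : ltlf) : property :=
  fun pi => exists n, sat (mkseq pi n.+1) phi.
Definition Forall_ltlf (phi : ltlf) : property :=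
  fun pi => forall n, sat (mkseq pi n.+1) phi.

Definition ag_strategy := seq {set X} -> {set Y}.
(* The value of an environment strategy on the empty history is never used. *)
Definition env_strategy := seq {set Y} -> {set X}.

Definition follows_ag (s : ag_strategy) (pi : trace) : Prop :=
  forall i, ag_part (pi i) = s (mkseq (env_part \o pi) i).
Definition follows_env (s : env_strategy) (pi : trace) : Prop :=
  forall i, env_part (pi i) = s (mkseq (ag_part \o pi) i.+1).

(* The first n moves of the agent and of the environment. *)
Fixpoint moves (sa : ag_strategy) (se : env_strategy) (n : nat) :
    seq {set Y} * seq {set X} :=
  if n is m.+1 then
    let: (ys, xs) := moves sa se m in
    let ys' := rcons ys (sa xs) in (ys', rcons xs (se ys'))
  else ([::], [::]).

Definition play (sa : ag_strategy) (se : env_strategy) : trace := fun n =>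
  let: (ys, xs) := moves sa se n in
  union_letter (sa xs) (se (rcons ys (sa xs))).

Definition env_enforces (se : env_strategy) (P : property) : Prop :=
  forall sa : ag_strategy, P (play sa se).
Definition ag_enforces_under (sa : ag_strategy) (Task Env : property) : Prop :=
  forall se : env_strategy, env_enforces se Env -> Task (play sa se).
Definition consistent (Env : property) : Prop :=
  exists se : env_strategy, env_enforces se Env.

Record transducer := Transducer {
  tstate : finType;
  tinit : tstate;
  tdelta : tstate -> {set X} -> tstate;
  tout : tstate -> {set Y} }.

Definition finite_state (s : ag_strategy) : Prop :=
  exists A : transducer, forall h, s h = tout (foldl (@tdelta A) (tinit A) h).

Record ts := TS {
  state : finType;
  init : state;
  delta : state -> letter -> state }.

Definition start_at (D : ts) (q : state D) : ts := TS q (@delta D).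

Definition run_word (D : ts) (w : seq letter) : state D :=
  foldl (@delta D) (init D) w.
Definition run (D : ts) (pi : trace) : nat -> state D :=
  fun n => run_word D (mkseq pi n).

Record dfa := DFA { dfa_ts :> ts; final : {set state dfa_ts} }.

Definition accepts (M : dfa) (w : seq letter) : Prop :=
  run_word M w \in final M.
Definition recognises (M : dfa) (phi : ltlf) : Prop :=
  forall w, accepts M w <-> w <> [::] /\ sat w phi.
(* Convention on the automaton of the safety specification. safe (F U {iota})
   is meant to exempt only the empty prefix from F; if iota could be re-entered
   it would also exempt every prefix leading back to iota (which is rejected),
   and would not capture A phi. *)
Definition never_returns_to_init (D : ts) : Prop :=
  forall w, w <> [::] -> run_word D w <> init D.

Definition reach (Q : finType) (T : {set Q}) : (nat -> Q) -> Prop :=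
  fun r => exists k, r k \in T.
Definition safe (Q : finType) (T : {set Q}) : (nat -> Q) -> Prop :=
  fun r => forall k, r k \in T.

(* For a DFA M recognising phi, ConvertDA(E phi) is (M, reach (convert_ex M))
   and ConvertDA(A phi) is (M, safe (convert_all M)). *)
Definition convert_ex (M : dfa) : {set state M} := final M.
Definition convert_all (M : dfa) : {set state M} := final M :|: [set init M].

Definition ag_wins (D : ts) (alpha : (nat -> state D) -> Prop)
    (s : ag_strategy) (q : state D) : Prop :=
  forall pi, follows_ag s pi -> alpha (run (start_at q) pi).
Definition env_wins (D : ts) (alpha : (nat -> state D) -> Prop)
    (s : env_strategy) (q : state D) : Prop :=
  forall pi, follows_env s pi -> alpha (run (start_at q) pi).

(* The agent's own move in state q is f q, so the fold below is the run of D on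
   the agent's previous moves joined with the history h. *)
Definition Strategy (D : ts) (f : state D -> {set Y}) : ag_strategy :=
  fun h => f (foldl (fun q x => delta q (union_letter (f q) x)) (init D) h).

(* Y_0 ... Y_k is mapped to f q_k Y_k, with q_0 ... q_k the run of D on
   Y_0 ... Y_(k-1) joined with the environment's own replies. *)
Definition Strategy_env (D : ts) (f : state D -> {set Y} -> {set X}) :
    env_strategy := fun h =>
  if h is y :: h' then
    f (foldl (fun q y' => delta q (union_letter y' (f q y')))
             (init D) (belast y h'))
      (last y h')
  else set0.

(* Solve_p is known only through its specification: these relate a game to any
   admissible result of solving it. *)
Definition Solve_ag (D : ts) (alpha : (nat -> state D) -> Prop)
    (W : {set state D}) (f : state D -> {set Y}) : Prop :=
  (forall q, q \in W <-> exists s, ag_wins alpha s q) /\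
  (forall q, q \in W -> ag_wins alpha (Strategy (D := start_at q) f) q).
Definition Solve_env (D : ts) (alpha : (nat -> state D) -> Prop)
    (W : {set state D}) (f : state D -> {set Y} -> {set X}) : Prop :=
  (forall q, q \in W <-> exists s, env_wins alpha s q) /\
  (forall q, q \in W -> env_wins alpha (Strategy_env (D := start_at q) f) q).

(* None is the sink. insub q is Some q if q \in S and None otherwise; so the
   initial state is that of D provided init D \in S, the only case in which
   Restrict is meaningful. *)
Definition Restrict (D : ts) (S : {set state D}) : ts :=
  @TS (option {q : state D | q \in S}) (insub (init D))
      (fun q z => if q is Some q' then insub (delta (val q') z) else None).

Definition Product (D1 D2 : ts) : ts :=
  @TS (state D1 * state D2)%type (init D1, init D2)
      (fun q z => (delta q.1 z, delta q.2 z)).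

(* (T1 x S) U (Q1 x {sink}) *)
Definition goal (D1 D2 : ts) (T1 : {set state D1}) (S : {set state D2}) :
    {set state (Product D1 (Restrict S))} :=
  [set q | if q.2 is Some _ then q.1 \in T1 else true].

(* algorithm4 M1 M2 out: out is a possible output on automata M1, M2 for the
   two formulas, None standing for "Unrealisable". *)
Variant algorithm4 (M1 M2 : dfa) : option ag_strategy -> Prop :=
  Algorithm4 (S2 : {set state M2}) (f_env : state M2 -> {set Y} -> {set X})
    (D := Product M1 (Restrict S2))
    (R : {set state D}) (f : state D -> {set Y}) of
    Solve_env (safe (convert_all M2)) S2 f_env
  & Solve_ag (reach (goal (convert_ex M1) S2)) R f :
    algorithm4 M1 M2 (if init D \in R then Some (Strategy f) else None).

Definition solves_synthesis (Task Env : property) (out : option ag_strategy) :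
    Prop :=
  if out is Some s then finite_state s /\ ag_enforces_under s Task Env
  else ~ exists s, ag_enforces_under s Task Env.

Lemma mkseqSr (T : Type) (g : nat -> T) n :
  mkseq g n.+1 = rcons (mkseq g n) (g n).
Proof. by rewrite /mkseq -addn1 iotaD map_cat /= cats1. Qed.

Lemma ag_part_union y x : ag_part (union_letter y x) = y.
Proof.
apply/setP=> b; rewrite !inE mem_imset; last by move=> ? ? [].
by case: imsetP => [[]//|]; rewrite orbF.
Qed.

Lemma env_part_union y x : env_part (union_letter y x) = x.
Proof.
apply/setP=> b; rewrite !inE orbC mem_imset; last by move=> ? ? [].
by case: imsetP => [[]//|]; rewrite orbF.
Qed.

Lemma union_parts z : union_letter (ag_part z) (env_part z) = z.
Proof.
apply/setP=> -[b|b]; rewrite !inE.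
  rewrite orbC mem_imset ?inE; last by move=> ? ? [].
  by case: imsetP => [[]//|]; rewrite orbF.
rewrite mem_imset ?inE; last by move=> ? ? [].
by case: imsetP => [[]//|]; rewrite orbF.
Qed.

(* play sa se is the unique trace following both strategies. *)
Lemma playP sa se pi :
  follows_ag sa pi /\ follows_env se pi <-> pi =1 play sa se.
Proof.
split=> [[fa fe] n|eqpi].
  have mE m : moves sa se m = (mkseq (ag_part \o pi) m, mkseq (env_part \o pi) m).
    elim: m => [|m IHm] //=; rewrite IHm !mkseqSr /= -fa.
    by congr pair; congr rcons; rewrite (fe m) mkseqSr.
  by rewrite /play mE -fa -[in RHS](mkseqSr (ag_part \o pi)) -fe union_parts.
have mE m : moves sa se m = (mkseq (ag_part \o pi) m, mkseq (env_part \o pi) m).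
  elim: m => [|m IHm] //=; rewrite !mkseqSr /= eqpi /play; move: IHm.
  by case: (moves sa se m) => ys xs [-> ->]; rewrite ag_part_union env_part_union.
by split=> n; rewrite ?mkseqSr /= eqpi /play mE ?ag_part_union ?env_part_union.
Qed.

Lemma runS (D : ts) (pi : trace) n :
  run D pi n.+1 = delta (run D pi n) (pi n).
Proof. by rewrite /run /run_word mkseqSr foldl_rcons. Qed.

(* Backward evaluation: the truth value of phi at the head of a word is a finite
   state computed from the last letter to the first. *)
Lemma backward_dfa (phi : ltlf) :
  exists (B : finType) (b0 : B) (st : letter -> B -> B) (acc : pred B),
    forall w i, i < size w ->
      (holds w i phi <-> acc (foldr st b0 (drop i w))).
Proof.
have ind (B : finType) (b0 : B) (st : letter -> B -> B) w i : i < size w ->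
    foldr st b0 (drop i w) = st (nth set0 w i) (foldr st b0 (drop i.+1 w)).
  by move=> lti; rewrite (drop_nth set0 lti).
elim: phi => [p|f [B [b0 [st [acc H]]]]
  |f [B [b0 [st [acc H]]]] g [B' [b0' [st' [acc' H']]]]
  |f [B [b0 [st [acc H]]]]
  |f [B [b0 [st [acc H]]]] g [B' [b0' [st' [acc' H']]]]].
- exists bool, false, (fun (z : letter) _ => p \in z), id => w i lti.
  by rewrite ind.
- exists B, b0, st, (predC acc) => w i lti /=.
  by rewrite H //; split=> /negP.
- exists (B * B')%type, (b0, b0'), (fun z b => (st z b.1, st' z b.2)),
    (fun b => acc b.1 && acc' b.2) => w i lti /=.
  rewrite H // H' //.
  have -> : foldr (fun z b => (st z b.1, st' z b.2)) (b0, b0') (drop i w)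
     = (foldr st b0 (drop i w), foldr st' b0' (drop i w)).
    by elim: (drop i w) => //= z s ->.
  by split=> /andP.
- exists (B * bool * bool)%type, (b0, false, false),
    (fun z b => (st z b.1.1, true, b.1.2 && acc b.1.1)), (fun b => b.2).
  move=> w i lti.
  have E s : foldr (fun z b => (st z b.1.1, true, b.1.2 && acc b.1.1))
      (b0, false, false) s = (foldr st b0 s, s != [::],
        (behead s != [::]) && acc (foldr st b0 (behead s))).
    by elim: s => //= z s ->.
  rewrite E /= -drop1 drop_drop add1n -size_eq0 size_drop -lt0n subn_gt0 /=.
  rewrite ltn_subRL add1n; split=> [[lt1 /H ->]|/andP[lt1 a]] //.
    by rewrite lt1.
  by split=> //; apply/H.
pose up z b : B * B' * bool := let b1 := st z b.1.1 in let b2 := st' z b.1.2 in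
  (b1, b2, acc' b2 || acc b1 && b.2).
exists (B * B' * bool)%type, (b0, b0', false), up, (fun b => b.2) => w.
have E s : (foldr up (b0, b0', false) s).1 = (foldr st b0 s, foldr st' b0' s).
  by elim: s => //= z s ->.
move=> i lti; have [n] := ubnP (size w - i); elim: n i lti => // n IHn i lti ltn.
have iU : holds w i (Until f g) <->
    holds w i g \/ (holds w i f /\ holds w i.+1 (Until f g)).
  split=> [[j [/andP[leij ltj] hg hf]]|[hg|[hf [j [/andP[leij ltj] hg hj]]]]].
  - case: (ltngtP i j) leij => // [ltij|->] _; last by left.
    right; split; first by apply: hf; rewrite leqnn.
    exists j; rewrite ltij; split=> // k /andP[ltik ltk].
    by apply: hf; rewrite ltk ltnW.
  - exists i; rewrite leqnn; split=> // k /andP[leik /(leq_ltn_trans leik)].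
    by rewrite ltnn.
  - exists j; rewrite ltj ltnW //; split=> // k /andP[leik ltk].
    by case: (ltngtP i k) leik => // [ltik|<-//] _; apply: hj; rewrite ltik.
rewrite iU H // H' // (ind _ _ up) //.
have -> b : (up (nth set0 w i) b).2 = acc' (st' (nth set0 w i) b.1.2)
    || acc (st (nth set0 w i) b.1.1) && b.2 by [].
rewrite E -!ind //; have [lt1|ge1] := ltnP i.+1 (size w).
  rewrite IHn //; last by rewrite subnS prednK ?subn_gt0 // -ltnS.
  split=> [[->|[-> ->]]|/orP[->|/andP[-> ->]]] //; [exact: orbT|by left|by right].
rewrite (drop_oversize ge1) /= andbF orbF; split=> [[//|[_ [j []]]]|->]; last by left.
by case/andP=> /(leq_trans ge1) le1 lt1; move: (leq_trans lt1 le1); rewrite ltnn.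
Qed.

(* Every formula has a DFA whose initial state is not revisited. *)
Lemma dfa_exists (phi : ltlf) :
  exists M : dfa, recognises M phi /\ never_returns_to_init M.
Proof.
have [B [b0 [st [acc H]]]] := backward_dfa phi.
pose d (q : option {ffun B -> B}) z :=
  Some (if q is Some g then [ffun b => g (st z b)] else [ffun b => st z b]).
pose D := @TS (option {ffun B -> B}) None d.
exists (@DFA D
  [set q : option {ffun B -> B} | if q is Some g then acc (g b0) else false]).
have E z w : exists2 g : {ffun B -> B}, run_word D (z :: w) = Some g
    & forall b, g b = foldr st b (z :: w).
  elim/last_ind: w => [|w z' [g eg Eg]].
    by eexists; [reflexivity | move=> b; rewrite ffunE].
  exists [ffun b => g (st z' b)].
    by rewrite /run_word -rcons_cons foldl_rcons -/(run_word _ _) eg.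
  by move=> b; rewrite ffunE Eg /= foldr_rcons.
split=> [[|z w]|[|z w] // _].
- by rewrite /accepts inE; split=> // -[].
- rewrite /accepts inE /= /sat (H (z :: w) 0) // drop0.
  by have [g -> ->] := E z w; split=> [|[]].
by have [g -> _] := E z w.
Qed.

Section Attractor.
Variables (D : ts) (T : {set state D}).

Definition pre (A : {set state D}) : {set state D} :=
  [set q | [exists y, forall x, delta q (union_letter y x) \in A]].
Definition attr : {set state D} := fixset (fun A => T :|: pre A).

Lemma attr_mono :
  {homo (fun A : {set state D} => T :|: pre A) : A B / A \subset B}.
Proof.
move=> A B /subsetP sAB; apply: setUS; apply/subsetP=> q; rewrite !inE.
case/existsP=> y /forallP Hy; apply/existsP; exists y; apply/forallP=> x.
exact: sAB.
Qed.

Lemma attrE : attr = T :|: pre attr.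
Proof. by rewrite [RHS](fixsetK attr_mono). Qed.

Definition level n : {set state D} := iter n (fun A => T :|: pre A) set0.

Lemma attr_positional : exists f : state D -> {set Y}, forall q, q \in attr ->
  ag_wins (reach T) (Strategy (D := start_at q) f) q.
Proof.
pose rank := fix_order (fun A => T :|: pre A).
pose good q y := [forall x, delta q (union_letter y x) \in level (rank q).-1].
pose f q := odflt set0 [pick y | good q y].
have fP q x : q \in attr -> q \notin T ->
    rank (delta q (union_letter (f q) x)) < rank q /\
    delta q (union_letter (f q) x) \in attr.
  move=> qA qT; have r0 : 0 < rank q by rewrite fix_order_gt0.
  have : q \in level (rank q) by rewrite (in_iter_fix_orderE (fun A => T :|: pre A)).
  rewrite -[in level _](prednK r0) /level iterS inE (negPf qT) inE.
  case/existsP=> y gy; rewrite /f; case: pickP => [y' /forallP/(_ x) /= H|/(_ y)].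
    split; last exact: (subsetP (iter_sub_fix attr_mono _)) H.
    by rewrite -[leqRHS](prednK r0) ltnS; exact: (fix_order_small attr_mono).
  by rewrite /good gy.
exists f => q qA pi fo.
pose r := run (start_at q) pi.
have rE n : foldl (fun q x => delta q (union_letter (f q) x)) q
    (mkseq (env_part \o pi) n) = r n.
  elim: n => [|n IHn] //; rewrite mkseqSr foldl_rcons IHn /r runS.
  congr delta; rewrite -[RHS]union_parts fo /Strategy /= IHn //.
have rS n : r n.+1 = delta (r n) (union_letter (f (r n)) (env_part (pi n))).
  by rewrite -!rE mkseqSr foldl_rcons.
suff main m n : rank (r n) < m -> r n \in attr -> exists k, r k \in T.
  exact: (main (rank q).+1 0).
elim: m n => // m IHm n ltm rA.
have [rT|rT] := boolP (r n \in T); first by exists n.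
have [lt1 A1] := fP _ (env_part (pi n)) rA rT.
by apply: (IHm n.+1); rewrite rS // (leq_trans lt1).
Qed.

Lemma coattr_positional : exists f : state D -> {set Y} -> {set X},
  forall q, q \notin attr ->
    env_wins (safe (~: T)) (Strategy_env (D := start_at q) f) q.
Proof.
pose f q y := odflt set0 [pick x | delta q (union_letter y x) \notin attr].
have fP q y : q \notin attr -> delta q (union_letter y (f q y)) \notin attr.
  rewrite {1}attrE !inE negb_or => /andP[_ /existsPn/(_ y)/forallPn[x Hx]].
  by rewrite /f; case: pickP => [//|/(_ x)]; rewrite Hx.
exists f => q qA pi fo; pose r := run (start_at q) pi.
have reply n s : foldl (fun q y => delta q (union_letter y (f q y))) q
    (mkseq (ag_part \o pi) n) = s ->
    env_part (pi n) = f s (ag_part (pi n)).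
  rewrite fo mkseqSr /Strategy_env => <-.
  by case: (mkseq _ n) => //= y w; rewrite belast_rcons last_rcons.
have rE n : foldl (fun q y => delta q (union_letter y (f q y))) q
    (mkseq (ag_part \o pi) n) = r n.
  elim: n => // n IHn.
  by rewrite mkseqSr foldl_rcons IHn /r runS /= -(reply _ _ IHn) union_parts.
have rA n : r n \notin attr.
  elim: n => // n IHn; rewrite /r runS -[pi n]union_parts.
  by rewrite (reply _ _ (rE n)); apply: fP.
by move=> n; move: (rA n); rewrite attrE !inE negb_or => /andP[].
Qed.

End Attractor.

Lemma Solve_ag_exists (D : ts) (T : {set state D}) :
  exists W f, Solve_ag (reach T) W f.
Proof.
have [f fP] := attr_positional T; have [g gP] := coattr_positional T.
exists (attr T), f; split=> // q; split=> [/fP|[s sP]]; first by eexists; eassumption.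
apply/idPn => /gP qA.
have [fs fg] := (playP s (Strategy_env (D := start_at q) g) _).2 (frefl _).
by have [k kT] := sP _ fs; have := qA _ fg k; rewrite inE kT.
Qed.

Lemma Solve_env_exists (D : ts) (T : {set state D}) :
  exists W f, Solve_env (safe T) W f.
Proof.
have [f fP] := attr_positional (~: T); have [g gP] := coattr_positional (~: T).
rewrite setCK in gP.
exists (~: attr (~: T)), g; split=> q; last by rewrite inE => /gP.
rewrite inE; split=> [/gP|[s sP]]; first by eexists; eassumption.
apply/negP => /fP qA.
have [fs fg] := (playP (Strategy (D := start_at q) f) s _).2 (frefl _).
by have [k] := qA _ fs; rewrite inE (sP _ fg k).
Qed.

Lemma algorithm4_total (M1 M2 : dfa) : exists out, algorithm4 M1 M2 out.
Proof.
have [S2 [fe HS]] := Solve_env_exists (convert_all M2).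
have [R [f HR]] := Solve_ag_exists (goal (convert_ex M1) S2).
by eexists; apply: Algorithm4 HS HR.
Qed.
End Ltlf.

(* Main.v *)
Require Import Defs.
From mathcomp Require Import all_boot.

Set Implicit Arguments.
Unset Strict Implicit.
Unset Printing Implicit Defensive.

(** An environment strategy that enforces [Forall_ltlf phi2] never leaves the
    winning region [S2] of the environment in the safety game: from any state on
    one of its plays, playing on with the same strategy wins.  Against such an
    environment the sink is therefore unreachable, so an agent reaching the goal
    satisfies [phi1] on some prefix.  Conversely, when the agent does not win the
    reachability game, determinacy yields an environment strategy that keeps the
    play inside [S2] and away from the final states of [M1]; it enforces
    [Forall_ltlf phi2] and defeats [Exists_ltlf phi1] against every agent. *)

Section Synthesis.
Variables X Y : finType.
Implicit Types (D : ts X Y) (M : dfa X Y) (pi rho : trace X Y).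
Implicit Types (sa : ag_strategy X Y) (se : env_strategy X Y).

(** Lets a trace of a residual strategy be read as a continuation of [pi]. *)
Definition splice n pi rho : trace X Y :=
  fun i => if i < n then pi i else rho (i - n).

Lemma map_mkseq_splice (T : Type) (g : letter X Y -> T) n k pi rho :
  mkseq (g \o splice n pi rho) (n + k) = mkseq (g \o pi) n ++ mkseq (g \o rho) k.
Proof.
rewrite /mkseq iotaD map_cat add0n -[in iota n k](addn0 n) iotaDl -map_comp.
congr cat; last by apply: eq_map => i; rewrite /= /splice ltnNge leq_addr addKn.
by apply/eq_in_map => i; rewrite mem_iota /= /splice => ->.
Qed.

Lemma map_mkseq_splice_small (T : Type) (g : letter X Y -> T) n k pi rho :
  k <= n -> mkseq (g \o splice n pi rho) k = mkseq (g \o pi) k.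
Proof.
move=> lekn; apply/eq_in_map => i; rewrite mem_iota /= /splice => ltik.
by rewrite (leq_trans ltik).
Qed.

Lemma run_splice D n k pi rho :
  run D (splice n pi rho) (n + k) = run (start_at (run D pi n)) rho k.
Proof. by rewrite /run /run_word (map_mkseq_splice id) foldl_cat. Qed.

Lemma follows_env_splice se n pi rho :
    follows_env se pi ->
    follows_env (fun h => se (mkseq (@ag_part X Y \o pi) n ++ h)) rho ->
  follows_env se (splice n pi rho).
Proof.
move=> fpi frho i; rewrite {1}/splice; case: ltnP => [ltin | leni].
  by rewrite map_mkseq_splice_small.
(* The history at [i] includes the agent's current move: [n] moves of [pi], then [(i - n).+1] of
   [rho]. *)
by rewrite -[in RHS](subnKC leni) -addnS map_mkseq_splice frho.
Qed.

(** [pi] is the play against the agent that replays the moves of [pi], reading only the length of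
    the history. [playP] gives pointwise equality, hence the extensionality hypothesis on [P]. *)
Lemma env_enforces_follows se (P : property X Y) pi :
    (forall rho, pi =1 rho -> P rho -> P pi) ->
    env_enforces se P -> follows_env se pi -> P pi.
Proof.
move=> extP enfP fpi.
pose sa : ag_strategy X Y := fun h => ag_part (pi (size h)).
apply: (extP (play sa se)) => //; apply/playP; split=> // i.
by rewrite /sa size_mkseq.
Qed.

Lemma Forall_ltlf_follows se phi pi :
  env_enforces se (Forall_ltlf phi) -> follows_env se pi -> Forall_ltlf phi pi.
Proof.
apply: env_enforces_follows => rho eq_pi Prho n.
by rewrite (eq_mkseq eq_pi).
Qed.

Lemma Exists_ltlfP M phi pi :
  recognises M phi ->
  Exists_ltlf phi pi <-> reach (convert_ex M) (run M pi).
Proof.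
move=> recM; split=> [[n phin] | [[|n] kF]].
- by exists n.+1; apply/recM.
(* The empty word is rejected, so the goal is not met at index 0. *)
- by have /recM[] : accepts M [::] by [].
by exists n; have /recM[] : accepts M (mkseq pi n.+1) by [].
Qed.

Lemma Forall_ltlfP M phi pi :
    recognises M phi -> never_returns_to_init M ->
  Forall_ltlf phi pi <-> safe (convert_all M) (run M pi).
Proof.
move=> recM noret; split=> [phipi [|n] | safepi n].
- by rewrite !inE eqxx orbT.
- by rewrite inE; apply/orP; left; apply/recM.
have /setUP[/recM[] // | /set1P] := safepi n.+1.
by move=> eq_init; case: (noret (mkseq pi n.+1)).
Qed.

Lemma run_Product D1 D2 pi n :
  run (Product D1 D2) pi n = (run D1 pi n, run D2 pi n).
Proof. by elim: n => // n IHn; rewrite !runS IHn. Qed.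

(** The sink is absorbing, so a run outside it at [n] has never left [S]. *)
Lemma run_Restrict_Some D (S : {set state D}) pi n q :
  run (Restrict S) pi n = Some q -> run D pi n = val q.
Proof.
have insub_val p (u : {p | p \in S}) : insub p = Some u -> p = val u.
  by have [v _ <-|//] := insubP {p | p \in S} p => -[->].
elim: n q => [|n IHn] q; first exact: insub_val.
rewrite !runS; case: (run _ pi n) IHn => [p|] //= /(_ p erefl) ->.
exact: insub_val.
Qed.

Lemma run_Restrict_in D (S : {set state D}) pi n :
  (forall k, run D pi k \in S) -> run (Restrict S) pi n.
Proof.
move=> inS; have insubS p : p \in S -> (insub p : option {p | p \in S}).
  by move=> pS; case: insubP; rewrite ?pS.
elim: n => [|n IHn]; first exact/insubS/(inS 0).
rewrite runS; case Ep: (run _ pi n) IHn => [p|] //= _.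
by rewrite -(run_Restrict_Some Ep) -runS insubS.
Qed.

Lemma Solve_env_sub D (T S : {set state D}) f :
  Solve_env (safe T) S f -> S \subset T.
Proof.
case=> winS _; apply/subsetP => q /winS[se se_wins].
(* Winning quantifies over traces, so one must be exhibited; its index 0 is [q]. *)
have [_ fe] := (playP (fun=> set0) se _).2 (frefl _).
exact: (se_wins _ fe 0).
Qed.

Lemma env_enforces_run_in M phi (S : {set state M}) f se pi n :
    recognises M phi -> never_returns_to_init M ->
    Solve_env (safe (convert_all M)) S f ->
    env_enforces se (Forall_ltlf phi) -> follows_env se pi ->
  run M pi n \in S.
Proof.
move=> recM noret [winS _] enf fpi; apply/winS.
(* The winning strategy is the residual of [se] after [n] moves. *)
exists (fun h => se (mkseq (@ag_part X Y \o pi) n ++ h)) => rho frho k.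
rewrite -run_splice; move: (n + k); apply/(Forall_ltlfP _ recM noret).
exact/(Forall_ltlf_follows enf)/follows_env_splice.
Qed.

Lemma finite_state_Strategy D (f : state D -> {set Y}) : finite_state (Strategy f).
Proof.
by exists (@Transducer X Y (state D) (init D)
  (fun q x => delta q (union_letter (f q) x)) f).
Qed.

(** The agent wins everywhere on the attractor, so [q] lies outside it, where the environment can
    avoid [T] forever. *)
Lemma Solve_ag_determined D (T W : {set state D}) f q :
    Solve_ag (reach T) W f -> q \notin W ->
  exists se, env_wins (safe (~: T)) se q.
Proof.
move=> [winW _] qW; have [g attr_wins] := attr_positional T.
have [h coattr_wins] := coattr_positional T.
eexists; apply: coattr_wins; apply: contra qW => /attr_wins q_wins.
by apply/winW; eexists; exact: q_wins.
Qed.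

End Synthesis.

Theorem theorem6 (X Y : finType) (phi1 phi2 : ltlf X Y) (M1 M2 : dfa X Y) :
  recognises M1 phi1 ->
  recognises M2 phi2 ->
  never_returns_to_init M2 ->
  consistent (Forall_ltlf phi2) ->
  forall out : option (ag_strategy X Y),
    algorithm4 M1 M2 out ->
    solves_synthesis (Exists_ltlf phi1) (Forall_ltlf phi2) out.
Proof.
move=> rec1 rec2 noret _ _ [S2 f_env D R f solve2 solve].
case: ifPn => [initR | initR].
  split=> [|se enf]; first exact: finite_state_Strategy.
  have [fa fe] := (playP (Strategy f) se _).2 (frefl _).
  set pi := play _ _ in fa fe *.
  apply/(Exists_ltlfP _ rec1).
  have [k] : reach (goal (convert_ex M1) S2) (run D pi) by exact: solve.2 fa.
  have := @run_Restrict_in X Y M2 S2 pi k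
    (fun n => env_enforces_run_in n rec2 noret solve2 enf fe).
  rewrite run_Product inE /=; case: (run (Restrict S2) pi k) => // q _ kT.
  by exists k.
have [se se_wins] := Solve_ag_determined solve initR.
(* The sink belongs to the goal, so avoiding the goal also keeps the second component inside
   [S2]. *)
have off_goal pi n : follows_env se pi ->
    run M1 pi n \notin convert_ex M1 /\ run M2 pi n \in S2.
  move=> /se_wins/(_ n); rewrite -[run _ _ _]/(run D pi n) run_Product !inE /=.
  case Eq: (run (Restrict S2) pi n) => [q|] // offT; split=> //.
  by rewrite (run_Restrict_Some Eq) (valP q).
have enf : env_enforces se (Forall_ltlf phi2).
  move=> sa; have [_ fe] := (playP sa se _).2 (frefl _).
  apply/(Forall_ltlfP _ rec2 noret) => n.
  by apply: (subsetP (Solve_env_sub solve2)); have [] := off_goal _ n fe.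
case=> sa /(_ se enf) /(Exists_ltlfP _ rec1)[k kT].
have [_ fe] := (playP sa se _).2 (frefl _).
by have [/negP[]] := off_goal _ k fe.
Qed.
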